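(* Let a topological group $G$ be $\tau_g$-representable in a compact space $X$, and let $\mathcal U_X$ be the unique uniformity on $X$. The following conditions are equivalent: (a) for every entourage ${\rm U}\in\mathcal U_X$ there is ${\rm V}\in\mathcal U_X$ such that, whenever $f,h\in G$ and $(\imath_X^{\Gamma}(f),\imath_X^{\Gamma}(h))\in 2^{{\rm V}^2}$, there exists $g\in G$ such that $(f(x),g(x))\in{\rm U}$ and $(g^{-1}(x),h^{-1}(x))\in{\rm U}$ for all $x\in X$; (b) $G$ is Roelcke precompact and $b_rG=b_XG$.
   Context: All spaces are Tychonoff. A group $G$ is representable in $X$ if it is a subgroup of the homeomorphism group of $X$. For compact $X$, a topological group $(G,\tau)$ is $\tau_g$-representable in $X$ if $G$ is representable in $X$ and $\tau$ is the compact-open topology (which coincides with the $g$-topology $\tau_g$). $2^{X\times X}$ is the set of closed subsets of $X\times X$ (including $\emptyset$) with the Vietoris (= Fell) topology, a compact Hausdorff space. $\imath_X^{\Gamma}(g)=\{(x,g(x))\mid x\in X\}$; for $\tau_g$-representable $G$ in compact $X$ it is a topological embedding, and $b_XG$ is the closure of $\imath_X^{\Gamma}(G)$ in $2^{X\times X}$, a compactification of $G$ (graph compactification). For ${\rm V}\in\mathcal U_X$, ${\rm V}^2=\{((x,y),(x',y'))\mid(x,x')\in{\rm V},(y,y')\in{\rm V}\}$, and $2^{{\rm V}^2}$ is the entourage on $2^{X\times X}$ consisting of $(\emptyset,\emptyset)$ and all pairs $(F,T)$ of nonempty closed subsets of $X\times X$ such that $F\subset B(T,{\rm V}^2)$ and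 $T\subset B(F,{\rm V}^2)$, where $B(A,{\rm W})=\bigcup_{a\in A}\{b\mid(a,b)\in{\rm W}\}$. The Roelcke uniformity $L\wedge R$ on $G$ has as base the covers $\{OgO\mid g\in G\}$, $O$ a neighbourhood of $e$. $G$ is Roelcke precompact if $L\wedge R$ is totally bounded. The Roelcke compactification $b_rG$ is the Samuel compactification of $(G,L\wedge R)$ (its completion if $G$ is Roelcke precompact). Equality of compactifications of $G$ means existence of a homeomorphism between them commuting with the embeddings of $G$. *)

(* Defs.v *)
From HB Require Import structures.
From mathcomp Require Import all_boot all_order all_algebra.
From mathcomp Require Import all_classical all_reals topology.

Set Implicit Arguments.
Unset Strict Implicit.
Unset Printing Implicit Defensive.

Local Open Scope classical_set_scope.

Definition homeomorphism (X Y : topologicalType) (f : X -> Y) : Prop :=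
  continuous f /\
  exists f' : Y -> X, [/\ cancel f f', cancel f' f & continuous f'].

HB.mixin Record isTopologicalGroup G & Topological G & Group G := {
  mulg_continuous : continuous (fun xy : G * G => (xy.1 * xy.2)%g) ;
  invg_continuous : continuous (fun x : G => (x^-1)%g)
}.

#[short(type="topologicalGroupType")]
HB.structure Definition TopologicalGroup :=
  {G of Topological G & Group G & isTopologicalGroup G}.

(** [G] is identified with a subgroup of the homeomorphism group of [X] through
    the faithful action [rep_act]. *)
Record tau_g_representation (G : topologicalGroupType) (X : topologicalType) :=
  TauGRepresentation {
    rep_act :> G -> X -> X ;
    rep_homeo : forall g, homeomorphism (rep_act g) ;
    rep_one : rep_act 1%g = id ;
    rep_mul : forall g h, rep_act (g * h)%g = rep_act g \o rep_act h ;
    rep_inj : injective rep_act ;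
    rep_topology : forall A : set G,
      open A <-> exists2 B : set {compact-open, X -> X},
                   open B & A = (rep_act : G -> {compact-open, X -> X}) @^-1` B
  }.

Record hyperspace (T : topologicalType) := Hyperspace {
  hset :> set T ;
  hset_closed : closed hset
}.

HB.instance Definition _ (T : topologicalType) := gen_eqMixin (hyperspace T).
HB.instance Definition _ (T : topologicalType) :=
  gen_choiceMixin (hyperspace T).

(** Subbase of the Vietoris topology: [(U, true)] codes the closed sets
    contained in [U], [(U, false)] those that meet [U]. *)
Definition vietoris_subbase (T : topologicalType) (Ub : set T * bool) :
    set (hyperspace T) :=
  [set F | if Ub.2 then hset F `<=` Ub.1 else hset F `&` Ub.1 !=set0].

HB.instance Definition _ (T : topologicalType) :=
  isSubBaseTopological.Build (hyperspace T)
    [set Ub : set T * bool | open Ub.1] (@vietoris_subbase T).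

Definition ball_of (T : Type) (A : set T) (W : set (T * T)) : set T :=
  [set b | exists2 a, A a & W (a, b)].

Definition sq_ent (X : Type) (V : set (X * X)) : set ((X * X) * (X * X)) :=
  [set pq | V (pq.1.1, pq.2.1) /\ V (pq.1.2, pq.2.2)].

Definition hyper_ent (T : topologicalType) (W : set (T * T)) :
    set (hyperspace T * hyperspace T) :=
  [set FS | (hset FS.1 = set0 /\ hset FS.2 = set0) \/
    [/\ hset FS.1 !=set0, hset FS.2 !=set0,
        hset FS.1 `<=` ball_of FS.2 W & hset FS.2 `<=` ball_of FS.1 W]].

Definition graph (X : Type) (f : X -> X) : set (X * X) :=
  [set p | p.2 = f p.1].

Lemma graph_closed (X : topologicalType) (f : X -> X) :
  hausdorff_space X -> continuous f -> closed (graph f).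
Proof.
move=> hX cf [x y] clxy; rewrite /graph /=; apply: hX => A B yA fxB.
have nAB : nbhs (x, y) ((f @^-1` B) `*` A).
  by exists (f @^-1` B, A) => //=; split=> //; exact: cf.
have [[u v] /= [uv [Bu Av]]] := clxy _ nAB.
by exists v; split=> //; move: uv Bu; rewrite /graph /= => ->.
Qed.

Section graph_compactification.
Variables (G : topologicalGroupType) (X : topologicalType).
Hypothesis hX : hausdorff_space X.
Variable rho : tau_g_representation G X.

Definition graph_map (g : G) : hyperspace (X * X)%type :=
  Hyperspace (graph_closed hX (rep_homeo rho g).1).

Definition graph_compactification : topologicalType :=
  set_type (closure (range graph_map)).

Definition graph_embedding (g : G) : graph_compactification :=
  SigSub (mem_set (subset_closure (imageT graph_map g))).

End graph_compactification.

Record is_uniformity (T : Type) (V : set_system (T * T)) : Prop := {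
  unif_filter : Filter V ;
  unif_diagonal : forall A, V A -> diagonal `<=` A ;
  unif_inv : forall A, V A -> V (A^-1)%relation ;
  unif_split : forall A, V A -> exists2 B, V B & (B \; B)%relation `<=` A
}.

Definition totally_bounded (T : Type) (V : set_system (T * T)) : Prop :=
  forall E, V E ->
    exists2 F : set T, finite_set F & \bigcup_(x in F) xsection E x = setT.

(** Precompact reflection: the finest totally bounded uniformity coarser than
    that of [U]. The union of all totally bounded uniformities coarser than the
    uniformity of [U] is itself one of them. *)
Definition precompact_reflection (U : uniformType) : Type := U.

HB.instance Definition _ (U : uniformType) :=
  Choice.copy (precompact_reflection U) U.

Section precompact_reflection.
Variable U : uniformType.

Definition precompact_ent : set_system (U * U) :=
  [set E | exists V : set_system (U * U),
    [/\ is_uniformity V, V `<=` entourage, totally_bounded V & V E]].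

Let join_ent (V W : set_system (U * U)) : set_system (U * U) :=
  [set E | exists A B, [/\ V A, W B & A `&` B `<=` E]].

Let join_uniformity V W :
  is_uniformity V -> is_uniformity W -> is_uniformity (join_ent V W).
Proof.
move=> [fV dV iV sV] [fW dW iW sW]; split.
- split.
  + by exists setT, setT; split=> //; exact: filterT.
  + move=> P Q [A [B [VA WB AB]]] [C [D [VC WD CD]]].
    exists (A `&` C), (B `&` D); split; [exact: filterI|exact: filterI|].
    by move=> z [[Az Cz] [Bz Dz]]; split; [apply: AB|apply: CD].
  + move=> P Q PQ [A [B [VA WB AB]]].
    by exists A, B; split=> //; exact: subset_trans AB PQ.
- move=> E [A [B [VA WB AB]]] z dz.
  by apply: AB; split; [exact: (dV _ VA)|exact: (dW _ WB)].
- move=> E [A [B [VA WB AB]]]; exists (A^-1)%relation, (B^-1)%relation.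
  by split; [exact: iV|exact: iW|move=> [x y] [Ax Bx]; exact: AB].
- move=> E [A [B [VA WB AB]]].
  have [A' VA' sA] := sV _ VA; have [B' WB' sB] := sW _ WB.
  exists (A' `&` B'); first by exists A', B'; split.
  move=> [x y] [z [Az Bz] [Az' Bz']].
  by apply: AB; split; [apply: sA; exists z|apply: sB; exists z].
Qed.

Let join_totally_bounded V W :
  is_uniformity V -> is_uniformity W ->
  totally_bounded V -> totally_bounded W -> totally_bounded (join_ent V W).
Proof.
move=> [fV dV iV sV] [fW dW iW sW] tV tW E [A [B [VA WB AB]]].
have [A' VA' sA] := sV _ VA; have [B' WB' sB] := sW _ WB.
have [F finF cF] := tV _ (filterI VA' (iV _ VA')).
have [H finH cH] := tW _ (filterI WB' (iW _ WB')).
have [[x0]|U0] := pselect (exists x : U, True); last first.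
  exists set0 => //; apply/seteqP; split=> // x _.
  by exfalso; apply: U0; exists x.
pose S (ab : U * U) : set U :=
  xsection (A' `&` (A'^-1)%relation) ab.1 `&`
  xsection (B' `&` (B'^-1)%relation) ab.2.
pose c (ab : U * U) : U := xget x0 (S ab).
exists (c @` (F `*` H)).
  by apply: finite_image; exact: finite_setX.
apply/seteqP; split=> // x _.
have [a Fa ax] : (\bigcup_(a in F) xsection (A' `&` (A'^-1)%relation) a) x.
  by rewrite cF.
have [b Hb bx] : (\bigcup_(b in H) xsection (B' `&` (B'^-1)%relation) b) x.
  by rewrite cH.
exists (c (a, b)); first by exists (a, b).
have [] : S (a, b) (c (a, b)) by apply: (@xgetPex _ x0 (S (a, b))); exists x.
move=> /xsectionP /= [_ aC] /xsectionP /= [_ bC].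
move: ax bx => /xsectionP /= [ax _] /xsectionP /= [bx _].
by apply/xsectionP; apply: AB; split; [apply: sA; exists a|apply: sB; exists b].
Qed.

Let precompact_ent_filter : Filter precompact_ent.
Proof.
split.
- exists [set setT]; split=> //.
  + split=> //.
    * split=> //; first by move=> P Q -> ->; rewrite setIT.
      by move=> P Q PQ PT; move: PQ; rewrite PT subTset.
    * by move=> A ->.
    * by move=> A ->.
    * by move=> A ->; exists setT.
  + by move=> A ->; exact: entourageT.
  + move=> E ->; have [[x0]|U0] := pselect (exists x : U, True).
      exists [set x0]; first exact: finite_set1.
      by apply/seteqP; split=> // x _; exists x0 => //; apply/xsectionP.
    exists set0 => //; apply/seteqP; split=> // x _.
    by exfalso; apply: U0; exists x.
- move=> P Q [V [uV eV tV VP]] [W [uW eW tW WQ]].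
  exists (join_ent V W); split.
  + exact: join_uniformity.
  + move=> E [A [B [/eV VA /eW WB AB]]].
    by apply: (filterS AB); exact: filterI.
  + exact: join_totally_bounded.
  + by exists P, Q; split.
- move=> P Q PQ [V [uV eV tV VP]]; exists V; split=> //.
  by have fV := unif_filter uV; exact: filterS PQ VP.
Qed.

Let precompact_ent_diagonal A : precompact_ent A -> diagonal `<=` A.
Proof. by move=> [V [uV _ _ VA]]; exact: (unif_diagonal uV VA). Qed.

Let precompact_ent_inv A : precompact_ent A -> precompact_ent (A^-1)%relation.
Proof. by move=> [V [uV eV tV VA]]; exists V; split=> //; exact: (unif_inv uV). Qed.

Let precompact_ent_split A : precompact_ent A ->
  exists2 B, precompact_ent B & (B \; B)%relation `<=` A.
Proof.
move=> [V [uV eV tV VA]]; have [B VB sB] := unif_split uV VA.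
by exists B => //; exists V.
Qed.

HB.instance Definition _ := @isUniform.Build (precompact_reflection U)
  precompact_ent precompact_ent_filter precompact_ent_diagonal
  precompact_ent_inv precompact_ent_split.

End precompact_reflection.

(** Hausdorff completion of a uniform space, as its space of minimal Cauchy
    filters *)
Record completion (U : uniformType) := Completion {
  compl_filter : set_system U ;
  compl_proper : ProperFilter compl_filter ;
  compl_cauchy : cauchy compl_filter ;
  compl_minimal : forall F : set_system U, ProperFilter F -> cauchy F ->
    F `<=` compl_filter -> compl_filter `<=` F
}.

HB.instance Definition _ (U : uniformType) := gen_eqMixin (completion U).
HB.instance Definition _ (U : uniformType) := gen_choiceMixin (completion U).

Section completion.
Variable U : uniformType.

Definition completion_ent : set_system (completion U * completion U) :=
  filter_from (@entourage U) (fun E =>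
    [set FH : completion U * completion U |
      exists A : set U, [/\ compl_filter FH.1 A, compl_filter FH.2 A & A `*` A `<=` E]]).

Let completion_ent_filter : Filter completion_ent.
Proof.
apply: filter_from_filter; first by exists setT; exact: entourageT.
move=> E E' entE entE'; exists (E `&` E'); first exact: filterI.
move=> [F H] [A [/= FA HA sA]]; split; exists A; split=> //=.
  by move=> z /sA [].
by move=> z /sA [].
Qed.

Let completion_ent_diagonal A : completion_ent A -> diagonal `<=` A.
Proof.
move=> [E entE sE] [F H] /diagonalP <-; apply: sE.
have [[P Q] /= [FP FQ] PQ] := @compl_cauchy _ F _ entE.
exists (P `&` Q); have FF := compl_proper F; split; [exact: filterI..|].
by move=> [x y] [[Px _] [_ Qy]]; exact: PQ.
Qed.

Let completion_ent_inv A : completion_ent A -> completion_ent (A^-1)%relation.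
Proof.
move=> [E entE sE]; exists E => // -[F H] [P [FP HP PE]].
by apply: sE; exists P.
Qed.

Let completion_ent_split A : completion_ent A ->
  exists2 B, completion_ent B & (B \; B)%relation `<=` A.
Proof.
move=> [E entE sE]; have [D entD sD] := entourage_split_ex entE.
pose D' := D `&` (D^-1)%relation.
have entD' : entourage D' by exact: entourage_invI.
exists [set FH : completion U * completion U |
    exists P : set U, [/\ compl_filter FH.1 P, compl_filter FH.2 P & P `*` P `<=` D']].
  by exists D'.
move=> [F K] [H [P [/= FP HP PD]] [Q [/= HQ KQ QD]]]; apply: sE => /=.
have [FF HF KF] := And3 (compl_proper F) (compl_proper H) (compl_proper K).
have [z [Pz Qz]] : P `&` Q !=set0 by apply: (@filter_ex _ (compl_filter H)); exact: filterI.
exists (P `|` Q); split=> /=.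
- by apply: filterS FP; left.
- by apply: filterS KQ; right.
- move=> [x y] [/= Hx Hy]; apply: sD; exists z => /=.
    by case: Hx => [Px|Qx]; [case: (PD (x, z))|case: (QD (x, z))].
  by case: Hy => [Py|Qy]; [case: (PD (z, y))|case: (QD (z, y))].
Qed.

HB.instance Definition _ := @isUniform.Build (completion U)
  completion_ent completion_ent_filter completion_ent_diagonal
  completion_ent_inv completion_ent_split.

Lemma nbhs_cauchy (x : U) : cauchy (nbhs x).
Proof.
move=> E entE; have [D entD sD] := entourage_split_ex entE.
exists (xsection (D^-1)%relation x, xsection D x) => /=.
  by split; apply: nbhs_entourage => //; exact: entourage_inv.
by move=> [a b] [/= /xsectionP Da /xsectionP Db]; apply: sD; exists x.
Qed.

Lemma nbhs_minimal_cauchy (x : U) (F : set_system U) :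
  ProperFilter F -> cauchy F -> F `<=` nbhs x -> nbhs x `<=` F.
Proof.
move=> FF cF Fx A; rewrite -nbhs_entourageE => -[E entE EA].
have [[P Q] /= [FP FQ] PQ] := cF _ entE.
apply: filterS FQ => y Qy; apply: EA; apply/xsectionP; apply: (PQ (x, y)).
by split=> //; exact: nbhs_singleton (Fx _ FP).
Qed.

Definition completion_map (x : U) : completion U :=
  @Completion U (nbhs x) (nbhs_pfilter x) (@nbhs_cauchy x)
    (@nbhs_minimal_cauchy x).

End completion.

Definition samuel (U : uniformType) : topologicalType :=
  completion (precompact_reflection U).

Definition samuel_map (U : uniformType) (x : U) : samuel U :=
  completion_map (x : precompact_reflection U).

Definition roelcke_cover (G : groupType) (O : set G) : set (set G) :=
  [set [set (a * g * b)%g | a in O & b in O] | g in [set: G]].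

Definition cover_ent (T : Type) (C : set (set T)) : set (T * T) :=
  \bigcup_(A in C) (A `*` A).

Definition roelcke (G : topologicalGroupType) : Type := G.

HB.instance Definition _ (G : topologicalGroupType) :=
  Topological.copy (roelcke G) G.

Section roelcke.
Variable G : topologicalGroupType.

Definition roelcke_ent : set_system (G * G) :=
  filter_from (nbhs (1%g : G)) (fun O => cover_ent (roelcke_cover O)).

Let roelcke_ent_filter : Filter roelcke_ent.
Proof.
apply: filter_from_filter; first by exists setT; exact: filterT.
move=> O O' nO nO'; exists (O `&` O'); first exact: filterI.
move=> [x y] [_ [g _ <-] [/= [a [Oa Oa'] [b [Ob Ob'] abx]]
  [c [Oc Oc'] [d [Od Od'] cdy]]]].
split.
  exists [set (a * g * b)%g | a in O & b in O]; first by exists g.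
  by split; [exists a => //; exists b|exists c => //; exists d].
exists [set (a * g * b)%g | a in O' & b in O']; first by exists g.
by split; [exists a => //; exists b|exists c => //; exists d].
Qed.

Let roelcke_ent_diagonal A : roelcke_ent A -> diagonal `<=` A.
Proof.
move=> [O nO sO] [x y] /diagonalP <-; apply: sO.
exists [set (a * x * b)%g | a in O & b in O]; first by exists x.
have O1 := nbhs_singleton nO.
by split; exists 1%g => //; exists 1%g => //; rewrite mul1g mulg1.
Qed.

Let roelcke_ent_inv A : roelcke_ent A -> roelcke_ent (A^-1)%relation.
Proof.
move=> [O nO sO]; exists O => // -[x y] [W CW [Wx Wy]].
by apply: sO; exists W.
Qed.

Let small_nbhs (O : set G) : nbhs (1%g : G) O ->
  exists2 P, nbhs (1%g : G) P & forall a b, P a -> P b ->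
    O (a * b^-1)%g /\ O (a^-1 * b)%g.
Proof.
move=> nO.
have cm1 : {for (1%g, 1%g), continuous (fun z : G * G => (z.1 * z.2)%g)}.
  exact: mulg_continuous.
have [[P Q] /= [nP nQ] PQ] : nbhs ((1%g, 1%g) : G * G)
    ((fun z : G * G => (z.1 * z.2)%g) @^-1` O).
  by apply: cm1; rewrite /= mulg1.
pose R := P `&` Q.
have nR : nbhs (1%g : G) R by exact: filterI.
have nR' : nbhs (1%g : G) ((fun x : G => (x^-1)%g) @^-1` R).
  by apply: invg_continuous; rewrite invg1.
exists (R `&` (fun x : G => (x^-1)%g) @^-1` R); first exact: filterI.
move=> a b [[Pa Qa] [Pa' Qa']] [[Pb Qb] [Pb' Qb']].
by split; [exact: (PQ (a, b^-1)%g)|exact: (PQ (a^-1, b)%g)].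
Qed.

Let roelcke_ent_split A : roelcke_ent A ->
  exists2 B, roelcke_ent B & (B \; B)%relation `<=` A.
Proof.
move=> [O nO sO]; have [P nP PO] := small_nbhs nO.
exists (cover_ent (roelcke_cover P)); first by exists P.
move=> [x z] [y].
move=> [_ [g _ <-] [/= [a Pa [b Pb abx]] [c Pc [d Pd cdy]]]].
move=> [_ [h _ <-] [/= [e Pe [f Pf efy]] [k Pk [l Pl klz]]]].
apply: sO; exists [set (a * y * b)%g | a in O & b in O]; first by exists y.
split=> /=.
  exists (a * c^-1)%g; first by case: (PO a c).
  exists (d^-1 * b)%g; first by case: (PO d b).
  by rewrite -abx -cdy !mulgA mulgVK mulgK.
exists (k * e^-1)%g; first by case: (PO k e).
exists (f^-1 * l)%g; first by case: (PO f l).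
by rewrite -klz -efy !mulgA mulgVK mulgK.
Qed.

Let roelcke_ent_nbhs : nbhs = nbhs_ roelcke_ent.
Proof.
apply/funext => x; apply/seteqP; split=> A; last first.
  move=> [E [O nO sO] EA].
  have nOx : nbhs x [set (a * x * 1)%g | a in O].
    have cx : continuous (fun y : G => (y * x^-1)%g).
      move=> y; apply: (@continuous_comp _ _ _ (fun y : G => (y, x^-1)%g)
        (fun z : G * G => (z.1 * z.2)%g)); last exact: mulg_continuous.
      by apply: cvg_pair; [exact: cvg_id|exact: cvg_cst].
    have : nbhs x ((fun y : G => (y * x^-1)%g) @^-1` O).
      by apply: cx; rewrite mulgV.
    by apply: filterS => y Oy; exists (y * x^-1)%g => //; rewrite mulg1 mulgVK.
  apply: filterS nOx => y [a Oa <-]; apply: EA; apply/xsectionP; apply: sO.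
  exists [set (a * x * b)%g | a in O & b in O]; first by exists x.
  have O1 := nbhs_singleton nO.
  split=> /=; last by exists a => //; exists 1%g.
  by exists 1%g => //; exists 1%g => //; rewrite mul1g mulg1.
move=> nA.
pose m (z : G * G) := (z.1 * x * z.2)%g.
have cm : continuous m.
  move=> z.
  apply: (@continuous_comp _ _ _ (fun z : G * G => (z.1 * x, z.2)%g)
    (fun z : G * G => (z.1 * z.2)%g)); last exact: mulg_continuous.
  apply: cvg_pair; last exact: cvg_snd.
  apply: (@continuous_comp _ _ _ (fun z : G * G => (z.1, x))
    (fun z : G * G => (z.1 * z.2)%g)); last exact: mulg_continuous.
  by apply: cvg_pair; [exact: cvg_fst|exact: cvg_cst].
have [[P Q] /= [nP nQ] PQ] : nbhs ((1%g, 1%g) : G * G) (m @^-1` A).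
  by apply: cm; rewrite /m /= mul1g mulg1.
have [R nR RPQ] := small_nbhs (filterI nP nQ).
exists (cover_ent (roelcke_cover R)); first by exists R.
move=> y /xsectionP [_ [g _ <-] [/= [a Ra [b Rb abx]] [c Rc [d Rd cdy]]]].
have [[Pca _] _] := RPQ _ _ Rc Ra.
have [_ [_ Qbd]] := RPQ _ _ Rb Rd.
have := PQ (c * a^-1, b^-1 * d)%g (conj Pca Qbd).
by rewrite /m /= -abx -cdy !mulgA mulgVK mulgK.
Qed.

HB.instance Definition _ := @Nbhs_isUniform_mixin.Build (roelcke G)
  roelcke_ent roelcke_ent_filter roelcke_ent_diagonal
  roelcke_ent_inv roelcke_ent_split roelcke_ent_nbhs.

End roelcke.

Definition roelcke_precompact (G : topologicalGroupType) : Prop :=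
  totally_bounded (@entourage (roelcke G)).

Definition roelcke_compactification (G : topologicalGroupType) :
  topologicalType := samuel (roelcke G).

Definition roelcke_embedding (G : topologicalGroupType) (g : G) :
  roelcke_compactification G := samuel_map (g : roelcke G).

Definition eq_compactification (G : Type) (K1 K2 : topologicalType)
    (i1 : G -> K1) (i2 : G -> K2) : Prop :=
  exists2 f : K1 -> K2, homeomorphism f & forall g, f (i1 g) = i2 g.

(* Main.v *)
(** Write a pair [f, h] of [G] as Roelcke-small when [h = a f b] with [a, b]
    close to the identity. In terms of the action this means that some [g] has
    [g] uniformly close to [f] and [g^-1] uniformly close to [h^-1], so (a) says
    that the uniformity induced on [G] by the graphs is finer than the Roelcke
    uniformity. It is always coarser, because the graphs of [f] and [a f b] are
    close. Finally, a dense map from a uniform space [U] to a compact Hausdorff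
    space [K] is the Samuel compactification of a precompact [U] if and only if
    [U] carries the uniformity induced by [K]: in one direction every
    neighbourhood of the diagonal of [K] is an entourage, in the other the
    traces on [U] of the neighbourhood filters of [K] are exactly the minimal
    Cauchy filters of [U]. *)

Require Import Defs.
From HB Require Import structures.
From mathcomp Require Import all_boot all_order all_algebra.
From mathcomp Require Import finmap all_classical all_reals topology.

Local Open Scope classical_set_scope.

(** * Uniformities on compact spaces *)

Lemma entourage_split_sym (U : uniformType) (E : set (U * U)) : entourage E ->
  exists D : set (U * U), [/\ entourage D, forall x y, D (x, y) -> D (y, x) &
    forall x y z, D (x, y) -> D (y, z) -> E (x, z)].
Proof.
move=> /entourage_split_ex[D entD DE]; exists (D `&` D^-1)%relation; split.
- exact: entourage_invI.
- by move=> x y [].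
- by move=> x y z [Dxy _] [Dyz _]; apply: DE; exists y.
Qed.

Lemma entourage_is_uniformity (U : uniformType) :
  is_uniformity (@entourage U).
Proof.
split=> [|A|A|A]; first exact: entourage_filter.
- by move=> entA [x y] /diagonalP <-; exact: entourage_refl.
- exact: entourage_inv.
- exact: entourage_split_ex.
Qed.

(** If a neighbourhood [A] of [p] contained no section of a member of [B], the sets [xsection E p]
    minus [A] would generate a proper filter. By compactness it has a cluster point [q]; the
    triangle inequality makes [q] inseparable from [p], so the filter clusters at [p] while avoiding
    [A]. *)
Lemma compact_separated_uniformity (K : topologicalType)
    (B : set_system (K * K)) :
  compact [set: K] -> is_uniformity B ->
  (forall p E, B E -> nbhs p (xsection E p)) ->
  (forall p q, (forall E, B E -> E (p, q)) -> p = q) ->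
  nbhs = nbhs_ B.
Proof.
move=> cK [FB dB iB sB] nB sepB; apply/funext => p; apply/seteqP.
split=> [A nA|A [E BE EA]]; last by apply: filterS EA _; exact: nB.
apply: contrapT => nBA.
have pF : ProperFilter (filter_from B (fun E => xsection E p `\` A)).
  apply: filter_from_proper.
    apply: filter_from_filter; first by exists setT; exact: filterT.
    move=> E D BE BD; exists (E `&` D); first exact: filterI.
    by move=> q [/xsectionP[Eq Dq] Aq]; do 2?split=> //; exact/xsectionP.
  move=> E BE; apply: contrapT => E0; apply: nBA; exists E => // q Eq.
  by apply: contrapT => Aq; apply: E0; exists q.
have [q [_ clq]] : [set: K] `&` cluster
    (filter_from B (fun E => xsection E p `\` A)) !=set0.
  by apply: cK; exact: filterT.
have pq : p = q.
  apply: sepB => E BE; have [D BD DE] := sB _ BE.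
  have [r [[/xsectionP pr _] /xsectionP qr]] :
      (xsection D p `\` A) `&` xsection (D^-1)%relation q !=set0.
    by apply: clq; [exists D|apply: nB; exact: iB].
  by apply: DE; exists r.
rewrite -pq in clq.
have [r [[]]] : (xsection setT p `\` A) `&` A !=set0.
  by apply: clq => //; exists setT => //; exact: filterT.
by [].
Qed.

(** Otherwise every entourage has a pair outside [N]. The first coordinates of such pairs cluster at
    some [p], and a sufficiently small pair starting near [p] lies in a product neighbourhood of
    [(p, p)] inside [N]. *)
Lemma compact_nbhs_diagonal (K : uniformType) (N : set (K * K)) :
  compact [set: K] -> (forall p : K, nbhs (p, p) N) -> entourage N.
Proof.
move=> cK nN; apply: contrapT => entN.
have pF : ProperFilter (filter_from (@entourage K)
    (fun E => fst @` (E `\` N))).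
  apply: filter_from_proper.
    apply: filter_from_filter; first by exists setT; exact: entourageT.
    move=> E D entE entD; exists (E `&` D); first exact: filterI.
    by move=> _ [z [[Ez Dz] Nz] <-]; split; exists z.
  move=> E entE; apply: contrapT => E0; apply: entN.
  apply: filterS entE => z Ez; apply: contrapT => Nz; apply: E0.
  by exists z.1, z.
have [p [_ clp]] : [set: K] `&` cluster
    (filter_from (@entourage K) (fun E => fst @` (E `\` N))) !=set0.
  by apply: cK; exact: filterT.
have [[P Q] /= []] := nN p.
rewrite -nbhs_entourageE => -[E entE EP] [E' entE' EQ] PQN.
have [D [entD _ DE]] := entourage_split_sym _ _ (filterI entE entE').
have [x [[[a y] [Dxy Nxy] /= ax] /xsectionP px]] :
    (fst @` (D `\` N)) `&` xsection D p !=set0.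
  by apply: clp; [exists D|exact: nbhs_entourage].
subst a; apply: Nxy; apply: (PQN (x, y)); split=> /=.
  apply: EP; apply/xsectionP.
  by case: (DE _ _ _ (entourage_refl p entD) px).
by apply: EQ; apply/xsectionP; case: (DE _ _ _ px Dxy).
Qed.

Lemma separated_hausdorff (U : uniformType) :
  (forall x y : U, (forall E, entourage E -> E (x, y)) -> x = y) ->
  hausdorff_space U.
Proof.
move=> sep x y clxy; apply: sep => E entE.
have [D [entD symD DE]] := entourage_split_sym _ _ entE.
have [z [/xsectionP xz /xsectionP yz]] :=
  clxy _ _ (nbhs_entourage x entD) (nbhs_entourage y entD).
exact: DE xz (symD _ _ yz).
Qed.

(** * Separation in the completion *)

Lemma completion_eq (U : uniformType) (F H : completion U) :
  compl_filter F `<=` compl_filter H -> F = H.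
Proof.
move=> FH; have HF := compl_minimal (compl_proper F) (@compl_cauchy U F) FH.
case: F H FH HF => F pF cF mF [H pH cH mH] /= FH HF.
have FHE : F = H by apply/seteqP.
subst H; congr Completion; exact: Prop_irrelevance.
Qed.

Lemma completion_hausdorff (U : uniformType) : hausdorff_space (completion U).
Proof.
apply: separated_hausdorff => F H FH.
(* Inseparable Cauchy filters share arbitrarily small members, so their intersection is still
   Cauchy; minimality of [F] then puts [F] inside [H]. *)
pose I := compl_filter F `&` compl_filter H.
have [pF pH] := (compl_proper F, compl_proper H).
have pI : ProperFilter I.
  split; first by move=> [/filter_not_empty].
  split; first by split; exact: filterT.
    by move=> A B [FA HA] [FB HB]; split; exact: filterI.
  by move=> A B AB [FA HA]; split; exact: filterS AB _.
have cI : cauchy I.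
  move=> E entE; have [|A [FA HA AE]] := FH [set FH | exists A : set U,
      [/\ compl_filter FH.1 A, compl_filter FH.2 A & A `*` A `<=` E]].
    by exists E.
  by exists (A, A) => //; split.
apply: completion_eq => A FA.
by have [] := compl_minimal pI cI (fun _ h => h.1) FA.
Qed.

(** * Dense maps into a compact space that induce the uniformity of the source *)

Section dense_embedding.
Context (U K : uniformType) (i : U -> K).
Hypothesis dense_i : forall p, closure (range i) p.
Hypothesis entourage_i : forall E : set (U * U), entourage E <->
  exists2 D, entourage D & forall x y, D (i x, i y) -> E (x, y).

Let trace (p : K) : set_system U := filter_from (nbhs p) (preimage i).

Let trace_ent p E : entourage E -> trace p (i @^-1` xsection E p).
Proof. by move=> entE; exists (xsection E p) => //; exact: nbhs_entourage. Qed.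

Let trace_proper p : ProperFilter (trace p).
Proof.
apply: filter_from_proper => [|N nN].
  apply: filter_from_filter; first by exists setT; exact: filterT.
  by move=> N M nN nM; exists (N `&` M) => //; exact: filterI.
by have [_ [[x _ <-] Nx]] := dense_i _ _ nN; exists x.
Qed.

Let trace_cauchy p : cauchy (trace p).
Proof.
move=> E /entourage_i[D entD DE].
have [D' [entD' symD DD]] := entourage_split_sym _ _ entD.
exists (i @^-1` xsection D' p, i @^-1` xsection D' p) => /=.
  by split; exact: trace_ent.
move=> [x y] /= [/xsectionP px /xsectionP py]; apply: DE.
exact: DD (symD _ _ px) py.
Qed.

(** Some point of a small member of [F] is sent near [p], hence by smallness a whole member is sent
    near [p]. This serves both the minimality of traces and the surjectivity of [ext]. *)
Let trace_sub p (F : set_system U) : ProperFilter F -> cauchy F ->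
  (forall A N, F A -> nbhs p N -> i @` A `&` N !=set0) -> trace p `<=` F.
Proof.
move=> pF cF FN A [N]; rewrite -nbhs_entourageE => -[E entE EN] NA.
have [D [entD symD DE]] := entourage_split_sym _ _ entE.
have [|[P Q] /= [FP FQ] PQ] := cF [set xy | D (i xy.1, i xy.2)].
  by apply/entourage_i; exists D.
apply: filterS FQ => y Qy; apply: NA; apply: EN; apply/xsectionP.
have [_ [[x Px <-] /xsectionP px]] := FN _ _ FP (nbhs_entourage p entD).
exact: DE px (PQ (x, y) (conj Px Qy)).
Qed.

Let trace_minimal p (F : set_system U) : ProperFilter F -> cauchy F ->
  F `<=` trace p -> trace p `<=` F.
Proof.
move=> pF cF Fp; apply: trace_sub => // A N /Fp pA nN.
have [|x [Ax Nx]] := @filter_ex _ _ (trace_proper p) (A `&` i @^-1` N).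
  by apply: (@filterI _ _ (trace_proper p)) => //; exists N.
by exists (i x); split.
Qed.

Let ext (p : K) : completion U :=
  @Completion U (trace p) (trace_proper p) (@trace_cauchy p) (@trace_minimal p).

Let ext_continuous : continuous ext.
Proof.
move=> p N; rewrite -nbhs_entourageE.
move=> [M [E /entourage_i[D entD DE] /= EM] MN].
have [D1 [entD1 symD1 DD1]] := entourage_split_sym _ _ entD.
have [D2 [entD2 _ DD2]] := entourage_split_sym _ _ entD1.
apply: filterS (nbhs_entourage p entD2) => q /xsectionP pq /=.
apply: MN; apply/xsectionP; apply: EM => /=; exists (i @^-1` xsection D1 p).
split; first exact: trace_ent.
  exists (xsection D2 q); first exact: nbhs_entourage.
  by move=> y /xsectionP qy; apply/xsectionP; exact: DD2 pq qy.
move=> [x y] [/= /xsectionP px /xsectionP py]; apply: DE.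
exact: DD1 (symD1 _ _ px) py.
Qed.

Let ext_comp x : ext (i x) = completion_map x.
Proof.
apply/esym/completion_eq => A; rewrite /= -nbhs_entourageE.
move=> [E /entourage_i[D entD DE] EA].
exists (xsection D (i x)); first exact: nbhs_entourage.
by move=> y /xsectionP xy; apply: EA; apply/xsectionP; exact: DE.
Qed.

Let ext_inj : hausdorff_space K -> injective ext.
Proof.
move=> hK p q pq; apply: hK => A B nA nB.
have [|x [Ax Bx]] := @filter_ex _ _ (trace_proper p) (i @^-1` A `&` i @^-1` B).
  apply: (@filterI _ _ (trace_proper p)); first by exists A.
  by rewrite (congr1 (@compl_filter U) pq : trace p = trace q); exists B.
by exists (i x).
Qed.

(** A preimage of [F] is any cluster point in [K] of the image of [F] under [i]. *)
Let ext_surj : compact [set: K] -> forall F, exists p, ext p = F.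
Proof.
move=> cK F; have pF := compl_proper F.
have [p [_ clp]] : [set: K] `&` cluster (i @ compl_filter F) !=set0.
  by apply: cK; exact: filterT.
exists p; apply: completion_eq.
apply: trace_sub => [|A N FA nN]; first exact: compl_cauchy.
by apply: clp => //; apply: filterS FA => x Ax; exists x.
Qed.

(** The continuous bijection [ext] goes from a compact space to a Hausdorff one, so it is closed.
    The required homeomorphism goes the other way and is its inverse [f]. *)
Lemma eq_compactification_completion :
  hausdorff_space K -> compact [set: K] ->
  eq_compactification (@completion_map U) i.
Proof.
move=> hK cK; have /choice[f extK] := ext_surj cK.
have fK : cancel ext f by move=> p; apply: (ext_inj hK); rewrite extK.
exists f; last by move=> x; rewrite -ext_comp fK.
split; last by exists ext.
apply/continuous_closedP => A clA.
rewrite (_ : f @^-1` A = ext @` A); last first.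
  apply/seteqP; split=> [F Af|_ [p Ap <-]]; first by exists (f F).
  by rewrite /preimage /= fK.
apply: compact_closed; first exact: completion_hausdorff.
apply: continuous_compact; first exact: continuous_subspaceT.
by apply: subclosed_compact cK _.
Qed.

Lemma dense_totally_bounded :
  compact [set: K] -> totally_bounded (@entourage U).
Proof.
move=> /compact_near_coveringP cK E /entourage_i[D entD DE].
have [D' [entD' symD DD]] := entourage_split_sym _ _ entD.
(* Finite sets directed by inclusion: the near-covering form of compactness, applied along this
   filter, replaces the choice of a finite subcover. *)
pose fin : set_system (set U) :=
  filter_from finite_set (fun F0 => [set F | F0 `<=` F]).
have FF : Filter fin.
  apply: filter_from_filter; first by exists set0; exact: finite_set0.
  move=> A B finA finB; exists (A `|` B); first by rewrite finite_setU.
  by move=> F ABF; split=> x ?; apply: ABF; [left|right].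
have [|F finF FK] := cK _ fin (fun F q => exists2 x, F x & D (i x, q)) FF.
  move=> p _.
  have [_ [[x _ <-] /xsectionP px]] := dense_i p _ (nbhs_entourage p entD').
  exists (xsection D' p, [set F : set U | F x]) => /=.
    split; first exact: nbhs_entourage.
    by exists [set x]; [exact: finite_set1|move=> F; exact].
  move=> [q F] [/= /xsectionP pq Fx].
  by exists x => //; exact: DD (symD _ _ px) pq.
exists F => //; apply/seteqP; split=> // y _.
have [x Fx xy] := FK F (@subset_refl _ F) (i y) I.
by exists x => //; apply/xsectionP; exact: DE.
Qed.

End dense_embedding.

(** * The Samuel compactification of a precompact space *)

Lemma precompact_entE (U : uniformType) : totally_bounded (@entourage U) ->
  @precompact_ent U = @entourage U.
Proof.
move=> tbU; apply/seteqP; split=> [E [V [_ VU _ VE]]|E entE]; first exact: VU.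
by exists entourage; split=> //; exact: entourage_is_uniformity.
Qed.

(** The entourage [N] of the completion determined by [E] is carried to [K] by the homeomorphism.
    The result is a neighbourhood of the diagonal, hence an entourage since [K] is compact. Two
    points whose neighbourhood filters are [N]-close lie in a common [E]-small set. *)
Lemma completion_map_entourage (U : uniformType) (K : uniformType) (i : U -> K)
    (E : set (U * U)) :
  compact [set: K] -> eq_compactification (@completion_map U) i ->
  entourage E -> exists2 D, entourage D & forall x y, D (i x, i y) -> E (x, y).
Proof.
move=> cK [f [cf [g [fK gK cg]]] fi] entE.
pose N : set (completion U * completion U) := [set FH | exists A : set U,
  [/\ compl_filter FH.1 A, compl_filter FH.2 A & A `*` A `<=` E]].
have entN : entourage N by exists E.
exists [set pq | N (g pq.1, g pq.2)].
  apply: compact_nbhs_diagonal => // p.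
  have [D [entD symD DN]] := entourage_split_sym _ _ entN.
  exists (g @^-1` xsection D (g p), g @^-1` xsection D (g p)) => /=.
    by split; apply: cg; exact: nbhs_entourage.
  by move=> [a b] [/= /xsectionP pa /xsectionP pb]; exact: DN (symD _ _ pa) pb.
move=> x y /=; rewrite -!fi !fK => -[A [/= nxA nyA]]; apply; split=> /=.
  exact: nbhs_singleton nxA.
exact: nbhs_singleton nyA.
Qed.

Lemma samuel_induced_uniformityP (U K : uniformType) (i : U -> K) :
  hausdorff_space K -> compact [set: K] ->
  (forall p, closure (range i) p) ->
  (forall D, entourage D -> entourage [set xy | D (i xy.1, i xy.2)]) ->
  (totally_bounded (@entourage U) /\ eq_compactification (@samuel_map U) i) <->
  (forall E : set (U * U), entourage E ->
    exists2 D, entourage D & forall x y, D (i x, i y) -> E (x, y)).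
Proof.
move=> hK cK di ui; split.
  move=> [tbU eqi] E entE.
  apply: (@completion_map_entourage (precompact_reflection U)) => //.
  by rewrite /entourage /= precompact_entE.
move=> iE.
have entP (E : set (U * U)) : entourage E <->
    exists2 D, entourage D & forall x y, D (i x, i y) -> E (x, y).
  split; first exact: iE.
  by move=> [D entD DE]; apply: filterS (ui _ entD) => -[x y]; exact: DE.
have tbU : totally_bounded (@entourage U) by exact: dense_totally_bounded cK.
split=> //.
apply: (@eq_compactification_completion (precompact_reflection U)) => // E.
by rewrite /entourage /= precompact_entE.
Qed.

(** * The Vietoris hyperspace and its uniformity *)

Lemma vietoris_open_sub (T : topologicalType) (O : set T) : open O ->
  open [set F : hyperspace T | hset F `<=` O].
Proof.
move=> oO; exists [set [set F : hyperspace T | hset F `<=` O]].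
  move=> _ ->; exists [fset (O, true)]%fset.
    by move=> z; rewrite !inE => /eqP ->.
  by apply/seteqP; split=> [F /(_ (O, true))|F FO z];
    [apply; rewrite /= inE|rewrite /= inE => /eqP ->].
by rewrite bigcup_set1.
Qed.

Lemma vietoris_open_meet (T : topologicalType) (O : set T) : open O ->
  open [set F : hyperspace T | hset F `&` O !=set0].
Proof.
move=> oO; exists [set [set F : hyperspace T | hset F `&` O !=set0]].
  move=> _ ->; exists [fset (O, false)]%fset.
    by move=> z; rewrite !inE => /eqP ->.
  by apply/seteqP; split=> [F /(_ (O, false))|F FO z];
    [apply; rewrite /= inE|rewrite /= inE => /eqP ->].
by rewrite bigcup_set1.
Qed.

Lemma vietoris_cvg (T : topologicalType) (H : set_system (hyperspace T))
    (F : hyperspace T) : Filter H ->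
  (forall O, open O -> hset F `<=` O -> H [set S | hset S `<=` O]) ->
  (forall O, open O -> hset F `&` O !=set0 ->
    H [set S | hset S `&` O !=set0]) ->
  H --> F.
Proof.
move=> FH Hsub Hmeet A; rewrite nbhsE => -[N [[C CB CN] NF] NA].
apply: filterS NA _; move: NF; rewrite -CN => -[B BC BF].
apply: filterS (bigcup_sup BC) _.
have [D DO DB] := CB _ BC; rewrite -DB in BF *.
apply: filter_bigI => -[O b] OD; have oO : open O := set_mem (DO _ OD).
by have := BF _ OD; case: b {OD} => /= FO; [exact: Hsub|exact: Hmeet].
Qed.

Lemma hyperspace_compact (T : topologicalType) :
  compact [set: T] -> compact [set: hyperspace T].
Proof.
move=> cT; rewrite compact_ultra => H UH _.
(* The limit of the ultrafilter [H]: the points all of whose open neighbourhoods are met by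
   [H]-almost every set. *)
pose L := [set y : T | forall O, open O -> O y ->
  H [set F : hyperspace T | hset F `&` O !=set0]].
have clL : closed L.
  move=> y clLy O oO Oy.
  have [z [Lz Oz]] := clLy _ (open_nbhs_nbhs (conj oO Oy)).
  exact: Lz.
exists (Hyperspace clL); split=> //=; apply: vietoris_cvg => O oO /=.
  (* Each point outside [O] has an open neighbourhood [Q] that [H]-almost every set misses, because
     [H] is an ultrafilter. Compactness of the complement of [O] makes this uniform. *)
  move=> LO; have /compact_near_coveringP cO : compact (~` O).
    by apply: subclosed_compact cT _ => //; exact: open_closedC.
  have : \forall F \near H, ~` O `<=` (fun y => ~ hset F y).
    apply: cO => y Oy.
    have /existsNP[Q /not_implyP[oQ /not_implyP[Qy HQ]]] : ~ L y.
      by move=> /LO.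
    exists (Q, ~` [set F : hyperspace T | hset F `&` Q !=set0]) => /=.
      split; first exact: open_nbhs_nbhs.
      by have [] := in_ultra_setVsetC
        [set F : hyperspace T | hset F `&` Q !=set0] UH.
    by move=> [z F] [/= Qz FQ] Fz; apply: FQ; exists z.
  apply: filterS => F FO y Fy.
  by apply: contrapT => /FO.
by move=> [y [Ly Oy]]; exact: Ly.
Qed.

Definition hyperspace_ent (T : uniformType) :
    set_system (hyperspace T * hyperspace T) :=
  filter_from (@entourage T) (@hyper_ent T).

Lemma hyper_entS (T : topologicalType) (V W : set (T * T)) :
  V `<=` W -> hyper_ent V `<=` hyper_ent W.
Proof.
move=> VW [F S] [FS0|[F0 S0 FS SF]]; [by left|right; split=> //= y].
  by move=> /FS[x Sx Vxy]; exists x => //; exact: VW.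
by move=> /SF[x Fx Vxy]; exists x => //; exact: VW.
Qed.

Lemma hyperspace_is_uniformity (T : uniformType) :
  is_uniformity (@hyperspace_ent T).
Proof.
split.
- apply: filter_from_filter; first by exists setT; exact: entourageT.
  move=> V W entV entW; exists (V `&` W); first exact: filterI.
  by move=> FS FSVW; split; apply: hyper_entS FSVW => z [].
- move=> A [W entW WA] [F S] /diagonalP <-; apply: WA.
  have [F0|/set0P F0] := eqVneq (hset F) set0; [by left|right].
  by split=> // y Fy; exists y => //; exact: entourage_refl.
- move=> A [W entW WA]; exists W => // -[F S] [[F0 S0]|[F0 S0 FS SF]].
    by apply: WA; left.
  by apply: WA; right.
- move=> A [W entW WA]; have [V entV VW] := entourage_split_ex entW.
  exists (hyper_ent V); first by exists V.
  move=> [F S] [Q FQ QS]; apply: WA; case: FQ QS => -[/= F0 Q0].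
    move=> [[_ S0]|[Q1]]; first by left.
    by move: Q1; rewrite /= Q0 => -[].
  move=> FQ QF [[/= Q1]|[/= _ S0 QS SQ]]; first by move: Q0; rewrite Q1 => -[].
  right; split=> //= y.
    move=> /FQ[x /QS[z Sz Vzx] Vxy]; exists z => //.
    by apply: VW; exists x.
  move=> /SQ[x /QF[z Fz Vzx] Vxy]; exists z => //.
  by apply: VW; exists x.
Qed.

Lemma hyper_ent_separated (T : uniformType) (F S : hyperspace T) :
  (forall E, hyperspace_ent T E -> E (F, S)) -> F = S.
Proof.
move=> FS.
have sub (P Q : hyperspace T) :
    (forall W, entourage W -> hyper_ent W (P, Q)) -> hset P `<=` hset Q.
  move=> PQ y Py; apply: (hset_closed (h := Q)) => A.
  rewrite -nbhs_entourageE => -[W entW WA].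
  (* [ball_of] is directed from its centre in [Q] to [y], whereas a section at [y] starts from [y];
     hence the inverse entourage. *)
  case: (PQ _ (entourage_inv entW)) => [[/= P0]|[_ _ /(_ _ Py)[x Qx Wxy] _]].
    by move: Py; rewrite P0.
  by exists x; split=> //; apply: WA; apply/xsectionP.
have [FS1 SF1] : hset F `<=` hset S /\ hset S `<=` hset F.
  split; apply: sub => W entW; first by apply: FS; exists W.
  have [[F0 S0]|[F0 S0 FSW SFW]] : hyper_ent W (F, S) by apply: FS; exists W.
    by left.
  by right.
move: F S FS1 SF1 {FS sub} => [F clF] [S clS] /= FS1 SF1.
have FSE : F = S by apply/seteqP.
subst S; congr Hyperspace; exact: Prop_irrelevance.
Qed.

Lemma hyper_ent_nbhs (T : uniformType) (F : hyperspace T) E :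
  compact [set: T] -> hyperspace_ent T E -> nbhs F (xsection E F).
Proof.
move=> cT [W entW WE].
suff : nbhs F [set S | hyper_ent W (F, S)].
  by apply: filterS => S FS; apply/xsectionP; exact: WE.
have [F0|/set0P F0] := eqVneq (hset F) set0.
  (* The empty set is an isolated point of the hyperspace. *)
  have : nbhs F [set S : hyperspace T | hset S `<=` set0].
    apply: open_nbhs_nbhs; split.
      by apply: vietoris_open_sub; exact: open0.
    by rewrite /= F0.
  by apply: filterS => S; rewrite /= subset0 => S0; left.
have [D [entD symD DW]] := entourage_split_sym _ _ entW.
have nsub : nbhs F [set S : hyperspace T | hset S `<=` ball_of F W].
  pose O := \bigcup_(x in hset F) interior (xsection W x).
  have : nbhs F [set S : hyperspace T | hset S `<=` O].
    apply: open_nbhs_nbhs; split; first apply: vietoris_open_sub.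
      by apply: bigcup_open => x _; exact: open_interior.
    by move=> x Fx; exists x => //; exact: nbhs_entourage.
  apply: filterS => S SO y /SO[x Fx /interior_subset/xsectionP xy].
  by exists x.
have nmeet : nbhs F [set S : hyperspace T | hset S `&` setT !=set0].
  apply: open_nbhs_nbhs; split; last by rewrite /= setIT.
  by apply: vietoris_open_meet; exact: openT.
have /compact_near_coveringP cF : compact (hset F).
  by apply: subclosed_compact cT _ => //; exact: hset_closed.
(* If [S] meets the [D]-ball of [y], then every point of that ball is [W]-close to [S]. By
   compactness of [F], finitely many such conditions on [S] suffice. *)
have nball : \forall S \near nbhs F, hset F `<=` ball_of (hset S) W.
  apply: (cF _ (nbhs F) (fun S => ball_of (hset S) W) (nbhs_filter F)) => y Fy.
  exists (xsection D y, [set S : hyperspace T |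
      hset S `&` interior (xsection D y) !=set0]) => /=.
    split; first exact: nbhs_entourage.
    apply: open_nbhs_nbhs; split.
      by apply: vietoris_open_meet; exact: open_interior.
    by exists y; split=> //; exact: nbhs_entourage.
  move=> [z S] [/= /xsectionP yz [x [Sx /interior_subset/xsectionP yx]]].
  by exists x => //; exact: DW (symD _ _ yx) yz.
apply: filterS (filterI nsub (filterI nmeet nball)).
by move=> S [SF [[x [Sx _]] FS]]; right; split=> //; exists x.
Qed.

(** * Compact products, the compact-open topology and compact subspaces *)

Lemma compact_prodT (S T : topologicalType) :
  compact [set: S] -> compact [set: T] -> compact [set: S * T].
Proof.
move=> /compact_near_coveringP cS /compact_near_coveringP cT.
apply/compact_near_coveringP => J F P FF nP.
have nS : \near F, [set: S] `<=` (fun x => forall y, P F (x, y)).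
  apply: (cS _ F (fun i x => forall y, P i (x, y)) FF) => x _.
  (* Tube argument: compactness of [T] gives one neighbourhood of [x] that works for the whole fibre
     over [x]. *)
  have nT : \forall xi \near filter_prod (nbhs x) F,
      [set: T] `<=` (fun y => P xi.2 (xi.1, y)).
    apply: (cT _ _ (fun xi y => P xi.2 (xi.1, y))) => y _.
    have [[N J0] /= [[[A B] /= [nA nB] ABN] FJ] NJP] := nP (x, y) I.
    exists (B, A `*` J0) => /=; first by split=> //; exists (A, J0).
    move=> [y' [x' i]] [/= By' [Ax' Ji]].
    by apply: (NJP (x', y', i)); split=> //; exact: ABN.
  by apply: filterS nT => -[x' i] xiP y; exact: xiP.
by apply: filterS nS => i iP [x y] _; exact: iP.
Qed.

(** For continuous [f] the compact-open topology is that of uniform convergence on compact sets, and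
    here the whole domain is one of them. *)
Lemma compact_open_nbhs_uniform (T : topologicalType) (U : uniformType)
    (f : T -> U) : compact [set: T] -> continuous f ->
  nbhs (f : {compact-open, T -> U}) =
  filter_from (@entourage U) (fun V => [set g | forall x, V (f x, g x)]).
Proof.
move=> cT cf.
have FF : Filter (filter_from (@entourage U)
    (fun V => [set g : T -> U | forall x, V (f x, g x)])).
  apply: filter_from_filter; first by exists setT; exact: entourageT.
  move=> V W entV entW; exists (V `&` W); first exact: filterI.
  by move=> g VW; split=> x; case: (VW x).
(* [compact_open_fam_compactP] requires a pointed codomain. *)
have [[u0]|U0] := pselect (exists u : U, True); last first.
  have gf (g : T -> U) : g = f.
    by apply/funext => x; exfalso; apply: U0; exists (f x).
  rewrite eqEsubset; split=> A.
    move=> /nbhs_singleton Af; exists setT; first exact: entourageT.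
    by move=> g _; rewrite (gf g).
  move=> [V entV VA]; have -> : A = setT; last exact: filterT.
  apply/seteqP; split=> // g _; apply: VA => x; rewrite (gf g).
  exact: entourage_refl.
pose pU : puniformType := HB.pack U (isPointed.Build U u0).
have famP := @compact_open_fam_compactP T pU f.
rewrite eqEsubset; split=> A.
  move: A; apply/(famP _ cf FF); apply/fam_cvgP => K cK P.
  move=> /uniform_nbhs[V [entV VP]]; exists V => //.
  by move=> g Vg; apply: VP => y _; exact: Vg.
move=> [V entV VA]; apply: filterS VA _.
have /(famP _ cf _)/fam_cvgP/(_ setT cT) :
  {compact-open, nbhs (f : {compact-open, T -> U}) --> f} by [].
apply; apply/uniform_nbhs; exists V; split=> // g Vg x; exact: Vg.
Qed.

Section set_type.
Context (U : uniformType) (A : set U).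

Lemma nbhs_set_type (p : A) (N : set A) : nbhs p N ->
  exists2 M, nbhs (set_val p) M & set_val @^-1` M `<=` N.
Proof.
move=> [_ [[O oO <-] Op] ON]; exists O => //.
exact: open_nbhs_nbhs.
Qed.

Lemma set_type_hausdorff : hausdorff_space U -> hausdorff_space A.
Proof.
move=> hU p q clpq; apply: val_inj; apply: hU => P Q nP nQ.
have [r [Pr Qr]] := clpq _ _ (initial_continuous nP) (initial_continuous nQ).
by exists (set_val r).
Qed.

Lemma set_type_compact : compact A -> compact [set: A].
Proof.
move=> cA F pF FT; have FA : F (set_val @^-1` A).
  by apply: filterS FT => p _; exact: set_valP.
have [u [Au clu]] := cA (set_val @ F) _ FA.
exists (SigSub (mem_set Au)); split=> // P N FP /nbhs_set_type[M nM MN].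
have [_ [[p Pp <-] Mp]] : set_val @` P `&` M !=set0.
  apply: (clu (set_val @` P) M _ nM).
  have : P `<=` set_val @^-1` (set_val @` P) by move=> p Pp; exists p.
  by move=> /filterS; exact.
by exists p; split=> //; exact: MN.
Qed.

End set_type.

Section hyperspace_uniform.
Context (T : uniformType) (cT : compact [set: T]).

Let hyperspace_nbhsE : @nbhs _ (hyperspace T) = nbhs_ (@hyperspace_ent T).
Proof.
apply: compact_separated_uniformity.
- exact: hyperspace_compact.
- exact: hyperspace_is_uniformity.
- by move=> F E; exact: hyper_ent_nbhs.
- exact: hyper_ent_separated.
Qed.

Let hU := hyperspace_is_uniformity T.

(** The uniformity is put on top of the existing Vietoris topology, so its closed subspaces keep the
    topology used in [graph_compactification]. *)
Definition hyperspace_uniform : uniformType :=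
  HB.pack_for uniformType (hyperspace T)
    (@Nbhs_isUniform_mixin.Build (hyperspace T) _ (unif_filter hU)
      (unif_diagonal hU) (unif_inv hU) (unif_split hU) hyperspace_nbhsE).

Lemma hyperspace_hausdorff : hausdorff_space (hyperspace T).
Proof.
exact: (@separated_hausdorff hyperspace_uniform (@hyper_ent_separated T)).
Qed.

End hyperspace_uniform.

Lemma sq_ent_entourage (X : uniformType) (W : set ((X * X) * (X * X))) :
  entourage W <-> exists2 V : set (X * X), entourage V & sq_ent V `<=` W.
Proof.
split=> [[[A B] /= [entA entB] ABW]|[V entV VW]]; last first.
  by apply: filterS VW _; exact: prod_entP.
exists (A `&` B); first exact: filterI.
move=> [[x y] [x' y']] [/= [Ax _] [_ By]].
have [[[a b] [a' b']] Wab /= [<- <- <- <-]] :=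
  ABW ((x, x'), (y, y')) (conj Ax By).
by [].
Qed.

(** * The Roelcke uniformity in terms of the action *)

Section roelcke_graph.
Context (G : topologicalGroupType) (X : uniformType).
Hypothesis (hX : hausdorff_space X) (cX : compact [set: X]).
Variable rho : tau_g_representation G X.

Let rhoM g h x : rho (g * h)%g x = rho g (rho h x).
Proof. by rewrite rep_mul. Qed.

Let rho1 x : rho 1%g x = x.
Proof. by rewrite rep_one. Qed.

Let rhoK g x : rho g^-1%g (rho g x) = x.
Proof. by rewrite -rhoM mulVg rho1. Qed.

Let rhoVK g x : rho g (rho g^-1%g x) = x.
Proof. by rewrite -rhoM mulgV rho1. Qed.

Lemma rep_nbhs1 (O : set G) : nbhs (1%g : G) O <->
  exists2 V, entourage V & [set g | forall x, V (x, rho g x)] `<=` O.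
Proof.
have nid := @compact_open_nbhs_uniform X X (rho 1%g) cX (rep_homeo rho 1%g).1.
split.
  rewrite nbhsE => -[N [/(rep_topology rho)[B oB ->] B1] BO].
  have : nbhs (rho 1%g : {compact-open, X -> X}) B by exact: open_nbhs_nbhs.
  rewrite nid => -[V entV VB]; exists V => // g Vg.
  by apply: BO; apply: VB => x; rewrite rho1.
move=> [V entV VO].
have : nbhs (rho 1%g : {compact-open, X -> X}) [set f | forall x, V (x, f x)].
  by rewrite nid; exists V => // g Vg x; have := Vg x; rewrite rho1.
rewrite nbhsE => -[B [oB B1] BV].
rewrite nbhsE; exists ((rho : G -> {compact-open, X -> X}) @^-1` B).
  by split=> //; apply/(rep_topology rho); exists B.
by move=> g /BV; exact: VO.
Qed.

Lemma graph_map_unif_continuous (V : set (X * X)) : entourage V ->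
  entourage [set fh : roelcke G * roelcke G |
    hyper_ent (sq_ent V) (graph_map hX rho fh.1, graph_map hX rho fh.2)].
Proof.
move=> entV; have [D [entD symD DV]] := entourage_split_sym _ _ entV.
pose O := [set g | forall x, D (x, rho g x)].
exists O; first by apply/rep_nbhs1; exists D.
move=> [f h] [_ [m _ <-]] [/= [a Oa [b Ob <-]] [c Oc [d Od <-]]].
have sub (a' b' c' d' : G) : O a' -> O b' -> O c' -> O d' ->
    graph (rho (a' * m * b')%g) `<=`
    ball_of (graph (rho (c' * m * d')%g)) (sq_ent V).
  move=> Oa' Ob' Oc' Od' [x y]; rewrite /graph /= => ->.
  (* Both graphs are parametrised by the common argument [z] of [m]. The points above it have first
     coordinates close to [z] and second coordinates close to [rho m z]. *)
  pose z := rho b' x.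
  exists (rho d'^-1%g z, rho c' (rho m z)).
    by rewrite /graph /= !rhoM rhoVK.
  rewrite /sq_ent /= !rhoM; split.
    apply: (DV _ z); last by apply: symD; exact: Ob'.
    by have := Od' (rho d'^-1%g z); rewrite rhoVK.
  by apply: (DV _ (rho m z)); [apply: symD; exact: Oc'|exact: Oa'].
have [[[x y] _]|X0] := pselect (exists z : X * X, True); last first.
  by left; split; apply/seteqP; split=> // z; exfalso; apply: X0; exists z.
right; split => /=; [| |exact: sub|exact: sub].
  by exists (x, rho (a * m * b)%g x).
by exists (x, rho (c * m * d)%g x).
Qed.

Lemma roelcke_ent_rep (E : set (roelcke G * roelcke G)) : entourage E <->
  exists2 U, entourage U & forall f h : G,
    (exists g : G, forall x,
      U (rho f x, rho g x) /\ U (rho (g^-1)%g x, rho (h^-1)%g x)) -> E (f, h).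
Proof.
split=> [[O /rep_nbhs1[V entV VO] OE]|[U entU UE]].
  exists (V `&` V^-1)%relation; first exact: entourage_invI.
  move=> f h [g gfh]; apply: OE; exists [set (a * f * b)%g | a in O & b in O].
    by exists f.
  have O1 : O 1%g by apply: VO => x; rewrite rho1; exact: entourage_refl.
  split=> /=; first by exists 1%g => //; exists 1%g => //; rewrite mul1g mulg1.
  (* Here [h] is written as [a * f * b] with [a = g * f^-1] and [b = g^-1 * h]; the two closeness
     conditions on [g] say that [a] and [b] lie in [O]. *)
  exists (g * f^-1)%g.
    apply: VO => x; have [[+ _] _] := gfh (rho f^-1%g x).
    by rewrite rhoVK rhoM.
  exists (g^-1 * h)%g; last by rewrite mulgVK mulgA mulgV mul1g.
  apply: VO => x; have [_ [_]] := gfh (rho h x).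
  by rewrite rhoK rhoM.
have [D [entD symD DU]] := entourage_split_sym _ _ entU.
exists [set g | forall x, D (x, rho g x)]; first by apply/rep_nbhs1; exists D.
move=> [f h] [_ [m _ <-]] [/= [a Da [b Db <-]] [c Dc [d Dd <-]]].
(* Between [a * m * b] and [c * m * d], this element differs from the first only in the left factor.
   Its inverse differs from that of the second only in the factor coming from [b] and [d], which is
   applied last. *)
apply: UE; exists (c * m * b)%g => x; split.
  by rewrite !rhoM; apply: DU (symD _ _ (Da _)) (Dc _).
rewrite !invgM !rhoM.
set y := rho _ (rho _ x).
apply: (DU _ y); first by have := Db (rho b^-1%g y); rewrite rhoVK.
by apply: symD; have := Dd (rho d^-1%g y); rewrite rhoVK.
Qed.

End roelcke_graph.

(** * Equivalence of the graph condition and the equality of compactifications *)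

Theorem theorem3p35 (G : topologicalGroupType) (X : uniformType)
    (hX : hausdorff_space X) (cX : compact [set: X])
    (rho : tau_g_representation G X) :
  (forall U : set (X * X), entourage U ->
     exists2 V : set (X * X), entourage V &
       forall f h : G,
         hyper_ent (sq_ent V) (graph_map hX rho f, graph_map hX rho h) ->
         exists g : G, forall x : X,
           U (rho f x, rho g x) /\ U (rho (g^-1)%g x, rho (h^-1)%g x))
  <->
  (roelcke_precompact G /\
   eq_compactification (@roelcke_embedding G) (graph_embedding hX rho)).
Proof.
have cXX := compact_prodT _ _ cX cX.
pose H := hyperspace_uniform _ cXX.
pose A : set H := closure (range (graph_map hX rho)).
pose K : uniformType := set_type A.
pose i : roelcke G -> K := graph_embedding hX rho.
have entK (D : set (K * K)) : entourage D <-> exists2 V, entourage V &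
    forall p q : K, hyper_ent (sq_ent V) (set_val p, set_val q) -> D (p, q).
  split=> [[E [W /sq_ent_entourage[V entV VW] WE] ED]|[V entV VD]].
    exists V => // p q pq; apply: ED; apply: WE; exact: hyper_entS VW _ pq.
  exists (hyper_ent (sq_ent V)); last by move=> [p q]; exact: VD.
  by exists (sq_ent V) => //; apply/sq_ent_entourage; exists V.
have hK : hausdorff_space K.
  exact: (@set_type_hausdorff H A (hyperspace_hausdorff _ cXX)).
have cK : compact [set: K].
  apply: (@set_type_compact H A).
  apply: subclosed_compact (hyperspace_compact _ cXX) _ => //.
  exact: closed_closure.
have di p : closure (range i) p.
  move=> N /(@nbhs_set_type H A)[M nM MN].
  have [_ [[g _ <-] Mg]] := set_valP p M nM.
  by exists (i g); split; [exists g|exact: MN].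
have ui D : entourage D -> entourage [set xy | D (i xy.1, i xy.2)].
  move=> /entK[V entV VD].
  have := graph_map_unif_continuous _ _ hX cX rho _ entV.
  by apply: filterS => -[f h] /= fh; exact: VD.
(* Condition (b) becomes: every Roelcke entourage contains the pullback of an entourage of [K]. By
   [entK] and [roelcke_ent_rep] this is (a). *)
apply: (iff_trans _ (iff_sym (samuel_induced_uniformityP _ _ _ hK cK di ui))).
split=> [a E|b U entU].
  move=> /(roelcke_ent_rep _ _ cX rho)[U /a[V entV VU] UE].
  exists [set pq | hyper_ent (sq_ent V) (set_val pq.1, set_val pq.2)].
    by apply/entK; exists V.
  by move=> f h /= /VU; exact: UE.
have [|D /entK[V entV VD] Dg] :=
    b [set fh : roelcke G * roelcke G | exists g : G, forall x : X,
      U (rho fh.1 x, rho g x) /\ U (rho (g^-1)%g x, rho (fh.2^-1)%g x)].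
  by apply/(roelcke_ent_rep _ _ cX rho); exists U.
exists V => // f h fh; apply: (Dg f h).
exact: (VD (i f) (i h)).
Qed.
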